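(* Let $\Gamma$ be a group (not necessarily abelian) with identity $e$, let $R=\bigoplus_{\tau\in\Gamma}R_\tau$ be a $\Gamma$-graded ring, let $\sigma$ be a ring endomorphism of $R$, let $\delta$ be a $\sigma$-derivation of $R$, let $A=R[t;\sigma,\delta]$ be the Ore extension, and let $\gamma\in\Gamma$. Then $A$ admits a $\Gamma$-grading $\{A_\alpha\}_{\alpha\in\Gamma}$ extending the grading of $R$ (that is, $R_\tau\subseteq A_\tau$ for all $\tau\in\Gamma$) with $t\in A_\gamma$ if and only if $(\sigma,\delta)$ is $\gamma$-compatible. Such a grading is unique, and it is given by \[A_\alpha=\bigoplus_{n\ge0}R_{\alpha\gamma^{-n}}t^n\quad(\alpha\in\Gamma).\]
   Context: Rings are associative with identity and nonzero; ring homomorphisms preserve the identity. A $\sigma$-derivation is an additive map $\delta\colon R\to R$ with $\delta(rs)=\delta(r)s+\sigma(r)\delta(s)$ for all $r,s\in R$. The Ore extension $R[t;\sigma,\delta]$ is the ring that is the free left $R$-module with basis $1,t,t^2,\dots$, with multiplication determined by $tr=\sigma(r)t+\delta(r)$ for $r\in R$. A $\Gamma$-graded ring is a ring $R=\bigoplus_{\tau\in\Gamma}R_\tau$ (direct sum of additive subgroups) with $R_\rho R_\tau\subseteq R_{\rho\tau}$ for all $\rho,\tau\in\Gamma$. The pair $(\sigma,\delta)$ is $\gamma$-compatible if $\sigma(R_\tau)\subseteq R_{\gamma\tau\gamma^{-1}}$ and $\delta(R_\tau)\subseteq R_{\gamma\tau}$ for all $\tau\in\Gamma$. *)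

(* Defs.v *)
From HB Require Import structures.
From mathcomp Require Import all_boot all_algebra.
From mathcomp Require Import finmap.
From mathcomp Require Import classical_sets functions.

Set Implicit Arguments.
Unset Strict Implicit.
Unset Printing Implicit Defensive.

Import GRing.Theory.

Local Open Scope classical_set_scope.
Local Open Scope ring_scope.

(* [W] is the internal direct sum of the additive subgroups [M i]: every
   element of [W] is [\sum_i f i] for exactly one finitely supported family
   [f] with [f i] in [M i], and all these sums lie in [W]. *)
Definition is_direct_sum (I : choiceType) (V : zmodType)
    (M : I -> set V) (W : set V) : Prop :=
  (forall i, zmod_closed [in M i]) /\
  set_bij [set f : {fsfun I -> V with 0} | forall i, M i (f i)] W
          (fun f => \sum_(i <- finsupp f) f i).

Definition is_grading (G : groupType) (R : nzRingType) (Rg : G -> set R) :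
    Prop :=
  is_direct_sum Rg [set: R] /\
  (forall (rho tau : G) (x y : R),
      Rg rho x -> Rg tau y -> Rg (rho * tau)%g (x * y)).

Definition is_skew_derivation (R : nzRingType) (sigma : {rmorphism R -> R})
    (delta : {additive R -> R}) : Prop :=
  forall r s : R, delta (r * s) = delta r * s + sigma r * delta s.

(* For noncommutative [R], an [lalgType R] is a ring with a left [R]-module
   structure satisfying [r *: (a * b) = (r *: a) * b]; then
   [r |-> r%:A = r *: 1] is a ring morphism with [r *: a = r%:A * a].
   Polynomials here only encode finitely supported coefficient sequences. *)
Definition is_ore_extension (R : nzRingType) (sigma : {rmorphism R -> R})
    (delta : {additive R -> R}) (A : lalgType R) (t : A) : Prop :=
  bijective (fun p : {poly R} => \sum_(i < size p) p`_i *: t ^+ i) /\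
  (forall r : R, t * r%:A = sigma r *: t + (delta r)%:A).

Definition is_compatible (G : groupType) (R : nzRingType) (Rg : G -> set R)
    (sigma : {rmorphism R -> R}) (delta : {additive R -> R}) (gamma : G) :
    Prop :=
  forall tau : G,
    sigma @` Rg tau `<=` Rg (gamma * tau * gamma^-1)%g /\
    delta @` Rg tau `<=` Rg (gamma * tau)%g.

Definition is_graded_extension (G : groupType) (R : nzRingType)
    (Rg : G -> set R) (A : lalgType R) (t : A) (gamma : G)
    (Ag : G -> set A) : Prop :=
  [/\ is_grading Ag,
      forall tau : G, [set r%:A | r in Rg tau] `<=` Ag tau
    & Ag gamma t].

(* A model of [R[t; sigma, delta]] on the left module [{poly R}], showing that
   [is_ore_extension] is satisfiable. Left multiplication by [t] is
   [ore_shift], so [(\sum_i a_i t^i) q = \sum_i a_i *: iter i ore_shift q]. *)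
Section OreModel.
Variables (R : nzRingType) (sigma : {rmorphism R -> R})
  (delta : {additive R -> R}).

Definition ore_shift (q : {poly R}) : {poly R} :=
  map_poly sigma q * 'X + map_poly delta q.

Definition ore_mul (p q : {poly R}) : {poly R} :=
  \sum_(i < size p) p`_i *: iter i ore_shift q.

Let ore_mul_widen n (p q : {poly R}) : (size p <= n)%N ->
  ore_mul p q = \sum_(i < n) p`_i *: iter i ore_shift q.
Proof.
move=> le_p; rewrite /ore_mul (big_ord_widen n
  (fun i => p`_i *: iter i ore_shift q) le_p) big_mkcond.
by apply: eq_bigr => i _; case: ltnP => // /(nth_default 0) ->; rewrite scale0r.
Qed.

Let shiftD : {morph ore_shift : p q / p + q}.
Proof. by move=> p q; rewrite /ore_shift !raddfD /= mulrDl addrACA. Qed.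

Let shift0 : ore_shift 0 = 0.
Proof. by rewrite /ore_shift !raddf0 mul0r addr0. Qed.

Let iterD i : {morph iter i ore_shift : p q / p + q}.
Proof. by elim: i => // i IH p q; rewrite !iterS IH shiftD. Qed.

Let ore_mulDl : left_distributive ore_mul +%R.
Proof.
move=> p q s; pose n := maxn (size p) (size q).
rewrite !(@ore_mul_widen n) ?leq_maxl ?leq_maxr ?size_polyD //.
by rewrite -big_split; apply: eq_bigr => i _; rewrite coefD scalerDl.
Qed.

Let ore_mulDr : right_distributive ore_mul +%R.
Proof.
move=> p q s; rewrite -big_split; apply: eq_bigr => i _.
by rewrite iterD scalerDr.
Qed.

Let ore_mulZ a p q : ore_mul (a *: p) q = a *: ore_mul p q.
Proof.
rewrite (@ore_mul_widen (size p)) ?size_scale_leq // scaler_sumr.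
by apply: eq_bigr => i _; rewrite coefZ scalerA.
Qed.

Let ore_mul0 q : ore_mul 0 q = 0.
Proof. by rewrite /ore_mul size_poly0 big_ord0. Qed.

Let ore_mulXn n q : ore_mul 'X^n q = iter n ore_shift q.
Proof.
rewrite /ore_mul size_polyXn big_ord_recr /= big1 => [|i _].
  by rewrite add0r coefXn eqxx scale1r.
by rewrite coefXn ltn_eqF // scale0r.
Qed.

Let ore_mul1 : left_id 1 ore_mul.
Proof. by move=> q; rewrite -(expr0 'X) ore_mulXn. Qed.

Hypothesis hdelta : is_skew_derivation sigma delta.

Let shiftZ a q :
  ore_shift (a *: q) = sigma a *: ore_shift q + delta a *: q.
Proof.
apply/polyP => i; rewrite /ore_shift !(coefD, coefZ, coefMX).
rewrite !coef_map_id0 ?raddf0 // !coefZ hdelta mulrDr rmorphM -addrA.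
by rewrite [delta a * _ + _]addrC; case: (i == 0)%N; rewrite ?mulr0.
Qed.

Let shiftXn (n : nat) : ore_shift 'X^n = 'X^(n.+1).
Proof.
have delta1 : delta 1 = 0.
  apply: (@addrI _ (delta 1)); rewrite addr0 -[RHS](congr1 delta (mulr1 1)).
  by rewrite hdelta mulr1 rmorph1 mul1r.
rewrite /ore_shift map_polyXn -exprSr -[RHS]addr0; congr (_ + _).
apply/polyP => i; rewrite coef_map_id0 ?raddf0 // coefXn coef0.
by case: eqP; rewrite ?raddf0.
Qed.

Let ore_mulr1 : right_id 1 ore_mul.
Proof.
move=> p; rewrite /ore_mul -[RHS]coefK poly_def; apply: eq_bigr => i _.
by congr (_ *: _); elim: (val i) => [|n /= ->]; rewrite ?expr0 ?shiftXn.
Qed.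

Let shift_sum n (F : 'I_n -> {poly R}) :
  ore_shift (\sum_(i < n) F i) = \sum_(i < n) ore_shift (F i).
Proof. exact: (big_morph _ shiftD shift0). Qed.

Let mul_suml n (F : 'I_n -> {poly R}) q :
  ore_mul (\sum_(i < n) F i) q = \sum_(i < n) ore_mul (F i) q.
Proof.
exact: (big_morph (ore_mul^~ q) (fun x y => ore_mulDl x y q) (ore_mul0 q)).
Qed.

Let shift_mul p q : ore_shift (ore_mul p q) = ore_mul (ore_shift p) q.
Proof.
rewrite -[p in RHS]coefK poly_def !shift_sum mul_suml; apply: eq_bigr => i _.
by rewrite !shiftZ shiftXn ore_mulDl !ore_mulZ !ore_mulXn.
Qed.

Let ore_mulA : associative ore_mul.
Proof.
move=> p q s.
have mulE x : ore_mul p x = \sum_(i < size p) p`_i *: iter i ore_shift x.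
  by [].
rewrite !mulE mul_suml; apply: eq_bigr => i _.
rewrite ore_mulZ; congr (_ *: _).
by elim: (val i) => //= n ->; rewrite shift_mul.
Qed.

Definition ore_poly (_ : is_skew_derivation sigma delta) : Type := {poly R}.
Local Notation ore := (ore_poly hdelta).

HB.instance Definition _ := GRing.Lmodule.on ore.
HB.instance Definition _ := GRing.Zmodule_isNzRing.Build ore
  ore_mulA ore_mul1 ore_mulr1 ore_mulDl ore_mulDr (oner_neq0 {poly R}).
HB.instance Definition _ := GRing.LSemiModule_isLSemiAlgebra.Build R ore
  (fun a p q => esym (ore_mulZ a p q)).

Lemma ore_extension_exists :
  exists (A : lalgType R) (t : A), is_ore_extension sigma delta t.
Proof.
have Xn n : ('X : ore) ^+ n = 'X^n :> {poly R}.
  elim: n => [//|n IH]; rewrite exprS IH.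
  by have := ore_mulXn 1 'X^n; rewrite /= shiftXn.
exists ore, ('X : {poly R}); split.
  exists id => p; under eq_bigr do rewrite Xn; rewrite -[RHS]coefK poly_def //.
move=> r; have -> : ('X : ore) * r%:A = ore_shift (r *: 1).
  exact: (ore_mulXn 1).
by rewrite shiftZ -(expr0 'X) shiftXn.
Qed.

End OreModel.

(* Main.v *)
Require Import Defs.
From HB Require Import structures.
From mathcomp Require Import all_boot all_algebra.
From mathcomp Require Import finmap.
From mathcomp Require Import boolp classical_sets functions.

Set Implicit Arguments.
Unset Strict Implicit.
Unset Printing Implicit Defensive.

Import GRing.Theory.

Local Open Scope classical_set_scope.
Local Open Scope ring_scope.

(** In any grading extending that of [R] with [t] in degree [gamma], a monomial
    [r t^n] with [r] in [R_(alpha gamma^-n)] must have degree [alpha].  So the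
    degree [alpha] part contains the additive group
    [B_alpha = \sum_n R_(alpha gamma^-n) t^n] ([ore_component]).  Decomposing
    each coefficient of an element of [A], the coefficient of [t^n] being
    decomposed along the shifted family [alpha |-> R_(alpha gamma^-n)], shows
    that [A] is the direct sum of the [B_alpha], whatever [sigma] and [delta]
    are ([ore_component_direct_sum]).  Two direct sum decompositions with the
    summands of one contained in those of the other are equal
    ([direct_sum_eq]), so [B] is the only candidate: this gives uniqueness and
    the formula ([graded_extension_eq]).

    It remains to see when [B_rho B_tau] lies in [B_(rho tau)].  If it does,
    then for [r] in [R_tau] the element [t r = sigma(r) t + delta(r)] lies in
    [B_(gamma tau)], and reading off its two coefficients gives compatibility
    ([graded_extension_compatible]).  Conversely, compatibility implies that
    left multiplication by [t] maps each [r t^n] of degree [tau] to degree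
    [gamma tau]; iterating this and multiplying by coefficients on the left
    gives all products ([compatible_graded_extension]). *)

(** * Additive subgroups given as sets *)

Section Closed.
Variables (V : zmodType) (S : set V).
Hypothesis closedS : zmod_closed [in S].

Lemma closed0 : S 0.
Proof. by case: closedS => + _; rewrite inE. Qed.

Lemma closedB x y : S x -> S y -> S (x - y).
Proof. by case: closedS => _ SB Sx Sy; rewrite -inE; apply: SB; rewrite inE. Qed.

Lemma closedD x y : S x -> S y -> S (x + y).
Proof.
move=> Sx Sy; rewrite -[y]opprK; apply: (closedB Sx).
by rewrite -sub0r; apply: closedB Sy; exact: closed0.
Qed.

Lemma closed_sum (I : Type) (s : seq I) (P : pred I) (F : I -> V) :
  (forall i, P i -> S (F i)) -> S (\sum_(i <- s | P i) F i).
Proof. by move=> SF; apply: big_ind => //; [exact: closed0|exact: closedD]. Qed.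

End Closed.

Lemma zmod_closed_in (V : zmodType) (S : set V) :
  S 0 -> (forall x y, S x -> S y -> S (x - y)) -> zmod_closed [in S].
Proof.
move=> S0 SB; split=> [|x y]; rewrite !inE //; exact: SB.
Qed.

(** * Internal direct sums *)

Section DirectSum.
Variables (I : choiceType) (V : zmodType).
Implicit Types (M : I -> set V) (W : set V).

Lemma sum_finsupp_widen (f : {fsfun I -> V with 0}) (S : {fset I}) :
  (finsupp f `<=` S)%fset -> \sum_(i <- finsupp f) f i = \sum_(i <- S) f i.
Proof.
by move=> sub; apply: big_fset_incl => // i _ /fsfun_dflt.
Qed.

Lemma sum_fsfun (S : {fset I}) (F : I -> V)
    (f := [fsfun i in S => F i] : {fsfun I -> V with 0}) :
  \sum_(i <- finsupp f) f i = \sum_(i <- S) F i.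
Proof.
rewrite (sum_finsupp_widen (finsupp_sub _ _ _)) big_seq [RHS]big_seq.
by apply: eq_bigr => i iS; rewrite fsfunE iS.
Qed.

(** All components of a homogeneous element vanish except the one of its own
    degree, here [h k].  The bijection [h], with inverse [g], allows families
    indexed by a translate of the grading group, such as the [x * f tau] with
    [x] of degree [rho], which have degree [rho * tau]. *)
Lemma direct_sum_homogeneous M W (J : choiceType) (h : J -> I) (g : I -> J)
    (S : {fset J}) (F : J -> V) (k : J) :
  is_direct_sum M W -> cancel h g -> cancel g h ->
  (forall j, M (h j) (F j)) -> (forall j, j \notin S -> F j = 0) ->
  M (h k) (\sum_(j <- S) F j) -> \sum_(j <- S) F j = F k.
Proof.
move=> [closedM [_ injM _]] hK gK MF F0 Mx; set x := \sum_(j <- S) F j in Mx *.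
pose T := [fset h j | j in S]%fset.
pose f1 : {fsfun I -> V with 0} := [fsfun i in T => F (g i)].
pose f2 : {fsfun I -> V with 0} := [fsfun i in [fset h k]%fset => x].
have f12 : f1 = f2.
  apply: injM; rewrite ?inE /=.
  - move=> i; rewrite fsfunE; case: ifP => _; last exact: closed0.
    by rewrite -[in M i](gK i).
  - move=> i; rewrite fsfunE inE; case: eqP => [-> //|_]; exact: closed0.
  rewrite !sum_fsfun big_seq_fset1 big_imfset /= => [|i j _ _ /(can_inj hK) //].
  by apply: eq_bigr => j _; rewrite hK.
have /fsfunP/(_ (h k)) := f12; rewrite !fsfunE inE eqxx hK => <-.
case: ifPn => //; apply: contraNeq => Fk; apply/imfsetP; exists k => //=.
by apply: contraNT Fk => /F0/esym/eqP; rewrite eq_sym.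
Qed.

Lemma direct_sum_sub M W i : is_direct_sum M W -> M i `<=` W.
Proof.
move=> [closedM [funM _ _]] x Mx.
have /= := funM [fsfun j in [fset i]%fset => x]; rewrite sum_fsfun big_seq_fset1.
apply=> j; rewrite fsfunE inE; case: eqP => [-> //|_]; exact: closed0.
Qed.

(** A direct sum is generated by its summands.  Quantifying over all additive
    subgroups [P] makes this an induction principle, and avoids manipulating
    the finitely supported families that witness generation. *)
Lemma direct_sum_ind M W (P : set V) :
  is_direct_sum M W -> zmod_closed [in P] -> (forall i, M i `<=` P) -> W `<=` P.
Proof.
move=> [_ [_ _ surjM]] closedP MP x /surjM [f /= Mf <-].
by apply: closed_sum => // i _; apply: MP (Mf i).
Qed.

(** Generation, in the form of [direct_sum_ind], gives surjectivity of the sum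
    map because its image is an additive subgroup containing each [M i]. *)
Lemma direct_sum_intro M W :
    (forall i, zmod_closed [in M i]) -> zmod_closed [in W] ->
    (forall i, M i `<=` W) ->
    (forall P : set V, zmod_closed [in P] -> (forall i, M i `<=` P) ->
       W `<=` P) ->
    (forall (S : {fset I}) (F : I -> V), (forall i, M i (F i)) ->
       \sum_(i <- S) F i = 0 -> forall i, i \in S -> F i = 0) ->
  is_direct_sum M W.
Proof.
move=> closedM closedW MW spanW indepM; split=> //; split.
- by move=> f /= Mf; apply: closed_sum => // i _; apply: MW (Mf i).
- move=> f g; rewrite !inE /= => Mf Mg eq_fg; apply/fsfunP => i.
  pose S := (finsupp f `|` finsupp g)%fset.
  have [iS|] := boolP (i \in S); last first.
    by rewrite inE => /norP[/fsfun_dflt-> /fsfun_dflt->].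
  apply/eqP; rewrite -subr_eq0; apply/eqP.
  apply: (indepM S (fun j => f j - g j)) => // [j|]; first exact: closedB.
  rewrite big_split /= sumrN -!sum_finsupp_widen ?fsubsetUl ?fsubsetUr //.
  by rewrite eq_fg subrr.
apply: spanW => [|i x Mx].
  apply: zmod_closed_in.
    exists [fsfun i in fset0 => 0]; last by rewrite sum_fsfun big_seq_fset0.
    by move=> i; rewrite fsfunE /=; exact: closed0.
  move=> _ _ [f Mf <-] [g Mg <-].
  pose S := (finsupp f `|` finsupp g)%fset.
  exists [fsfun j in S => f j - g j].
    move=> j; rewrite fsfunE; case: ifP => _; last exact: closed0.
    by apply: closedB.
  rewrite sum_fsfun big_split /= sumrN.
  by rewrite -!sum_finsupp_widen ?fsubsetUl ?fsubsetUr.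
exists [fsfun j in [fset i]%fset => x]; last by rewrite sum_fsfun big_seq_fset1.
by move=> j; rewrite fsfunE inE; case: eqP => [-> //|_]; exact: closed0.
Qed.

(** Decompose [x] in [M' i] along [M]: the terms are also homogeneous for [M'],
    so uniqueness of components for [M'] leaves only the term of index [i],
    which lies in [M i]. *)
Lemma direct_sum_eq M M' W :
  is_direct_sum M W -> is_direct_sum M' W -> (forall i, M i `<=` M' i) ->
  M = M'.
Proof.
move=> dsM dsM' sub; apply/funext => i; apply/seteqP; split=> [|x M'x].
  exact: sub.
have [_ [_ _ /(_ x (direct_sum_sub dsM' M'x)) [f /= Mf fx]]] := dsM.
have -> // : x = f i.
rewrite -fx.
apply: (direct_sum_homogeneous (h := id) (g := id) dsM') => //.
- by move=> j; apply: sub (Mf j).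
- by move=> j /fsfun_dflt.
by rewrite fx.
Qed.

End DirectSum.

(** Let [f 1] be the component of [1] in the neutral degree.  For [x]
    homogeneous, comparing components in [x = x * 1] gives [x = x * f 1]; by
    additivity this holds for every [x], in particular for [x = 1]. *)
Lemma grading_one (G : groupType) (R : nzRingType) (Rg : G -> set R) :
  is_grading Rg -> Rg 1%g 1.
Proof.
move=> [dsR mulR]; have [closedR [_ _ surjR]] := dsR.
have [f /= Rf f1] := surjR 1 Logic.I.
have idr x : x * f 1%g = x.
  apply: (direct_sum_ind dsR (P := [set x | x * f 1%g = x])) => //.
    apply: zmod_closed_in => [|y z /= yf zf]; first exact: mul0r.
    by rewrite mulrBl yf zf.
  move=> rho y Ry /=; rewrite -[RHS]mulr1 -f1 mulr_sumr; symmetry.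
  apply: (direct_sum_homogeneous (h := fun tau => (rho * tau)%g)
    (g := fun tau => (rho^-1 * tau)%g) dsR).
  - exact: mulKg.
  - exact: mulVKg.
  - by move=> tau; apply: mulR.
  - by move=> tau /fsfun_dflt->; rewrite mulr0.
  by rewrite -mulr_sumr f1 mulr1 mulg1.
by rewrite -[1]idr mul1r.
Qed.

(** * Coefficients in an Ore extension *)

(** The coefficient sequence of an element is the inverse of the evaluation of
    polynomials at [t] with coefficients on the left.  Packaged as an additive
    map with known values on monomials, it carries the whole freeness of [A]
    over [R]. *)
Lemma ore_coefficients (R : nzRingType) (A : lalgType R) (t : A)
    (sigma : {rmorphism R -> R}) (delta : {additive R -> R}) :
  is_ore_extension sigma delta t ->
  exists psi : {additive A -> {poly R}},
    (forall a, a = \sum_(i < size (psi a)) (psi a)`_i *: t ^+ i) /\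
    (forall r n, psi (r *: t ^+ n) = r *: 'X^n).
Proof.
pose phi (p : {poly R}) : A := \sum_(i < size p) p`_i *: t ^+ i.
case=> -[psi]; rewrite -/phi => phiK psiK _.
have phi_widen n (p : {poly R}) :
    (size p <= n)%N -> phi p = \sum_(i < n) p`_i *: t ^+ i.
  move=> le_pn; rewrite /phi (big_ord_widen n (fun i => p`_i *: t ^+ i)) //.
  rewrite big_mkcond; apply: eq_bigr => i _.
  by case: ltnP => // /(nth_default 0) ->; rewrite scale0r.
have phiB : zmod_morphism phi.
  move=> p q; pose n := maxn (size p) (size q).
  have le_n : (size (p - q)%R <= n)%N by rewrite /n -(size_polyN q) size_polyD.
  rewrite !(@phi_widen n) ?leq_maxl ?leq_maxr // -sumrB.
  by apply: eq_bigr => i _; rewrite coefB scalerBl.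
pose phiA : {additive {poly R} -> A} :=
  HB.pack phi (GRing.isZmodMorphism.Build _ _ phi phiB).
pose psiA : {additive A -> {poly R}} := HB.pack psi
  (GRing.isZmodMorphism.Build _ _ psi (can2_additive (f := phiA) phiK psiK)).
exists psiA; split=> [a|r n]; first by rewrite -[LHS]psiK.
apply: (can_inj phiK); rewrite /= psiK.
rewrite (@phi_widen n.+1); last first.
  by rewrite (leq_trans (size_scale_leq _ _)) ?size_polyXn.
rewrite big_ord_recr /= big1 => [|i _].
  by rewrite coefZ coefXn eqxx mulr1 add0r.
by rewrite coefZ coefXn ltn_eqF // mulr0 scale0r.
Qed.

(** * The only possible grading *)

Section OreGrading.
Variables (G : groupType) (R : nzRingType) (Rg : G -> set R).
Hypothesis gradR : is_grading Rg.
Variables (A : lalgType R) (t : A) (gamma : G) (psi : {additive A -> {poly R}}).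
Hypothesis psiK : forall a, a = \sum_(i < size (psi a)) (psi a)`_i *: t ^+ i.
Hypothesis psi_monomial : forall r n, psi (r *: t ^+ n) = r *: 'X^n.

Let dsR : is_direct_sum Rg setT. Proof. exact: gradR.1. Qed.
Let closedR tau : zmod_closed [in Rg tau]. Proof. exact: dsR.1. Qed.

(** The formula [\bigoplus_n R_(alpha gamma^-n) t^n] of the degree [alpha] part,
    expressed by a condition on each coefficient. *)
Definition ore_component (alpha : G) : set A :=
  [set a | forall n, Rg (alpha * gamma ^- n)%g (psi a)`_n].

Lemma ore_component_closed alpha : zmod_closed [in ore_component alpha].
Proof.
apply: zmod_closed_in => [n|x y Bx By n].
  by rewrite raddf0 coef0; exact: closed0.
by rewrite raddfB coefB; apply: closedB.
Qed.

Lemma ore_component_monomial alpha n r :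
  Rg (alpha * gamma ^- n)%g r -> ore_component alpha (r *: t ^+ n).
Proof.
move=> Rr m; rewrite psi_monomial coefZ coefXn.
by case: eqP => [->|_]; rewrite ?mulr1 ?mulr0 //; exact: closed0.
Qed.

Lemma ore_component_ind alpha (P : set A) :
  zmod_closed [in P] ->
  (forall n r, Rg (alpha * gamma ^- n)%g r -> P (r *: t ^+ n)) ->
  ore_component alpha `<=` P.
Proof.
move=> closedP Pmon a Ba; rewrite [a]psiK.
by apply: closed_sum => // i _; apply: Pmon (Ba i).
Qed.

(** For generation, each [r t^n] is a sum of homogeneous monomials since [r] is
    a sum of homogeneous elements of [R].  For independence, the coefficients
    of [t^n] in the terms of [\sum_beta F beta] have the pairwise distinct
    degrees [beta * gamma^-n] in [R]. *)
Lemma ore_component_direct_sum : is_direct_sum ore_component [set: A].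
Proof.
apply: direct_sum_intro => // [|||S F BF sumF alpha alphaS].
- exact: ore_component_closed.
- exact: zmod_closed_in.
- move=> P closedP BP a _; rewrite [a]psiK; apply: closed_sum => // -[n _] _ /=.
  apply: (direct_sum_ind dsR (P := [set r | P (r *: t ^+ n)])) => //.
    apply: zmod_closed_in => [|x y /= Px Py].
      by rewrite /= scale0r; exact: closed0.
    by rewrite scalerBl; exact: closedB.
  move=> tau r Rr; apply: (BP (tau * gamma ^+ n)%g); apply: ore_component_monomial.
  by rewrite mulgK.
(* Extracting a component requires a family that vanishes outside [S]. *)
pose F' beta := if beta \in S then F beta else 0.
have coefF' n : (psi (F' alpha))`_n = 0.
  have sum0 : \sum_(beta <- S) (psi (F' beta))`_n = 0.
    have sumF' : \sum_(beta <- S) F' beta = 0.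
      rewrite -[RHS]sumF big_seq [RHS]big_seq.
      by apply: eq_bigr => beta; rewrite /F' => ->.
    by rewrite -coef_sum -raddf_sum sumF' raddf0 coef0.
  rewrite -[RHS]sum0; symmetry.
  apply: (direct_sum_homogeneous (h := fun beta => (beta * gamma ^- n)%g)
    (g := fun beta => (beta * gamma ^+ n)%g) dsR).
  - exact: mulgVK.
  - exact: mulgK.
  - move=> beta; rewrite /F'; case: ifP => _; first exact: BF.
    by rewrite raddf0 coef0; exact: closed0.
  - by move=> beta /negbTE betaS; rewrite /F' betaS raddf0 coef0.
  by rewrite sum0; exact: closed0.
have -> : F alpha = F' alpha by rewrite /F' alphaS.
by rewrite [LHS]psiK big1 // => i _; rewrite coefF' scale0r.
Qed.

Lemma ore_component_monomials alpha :
  is_direct_sum (fun n => [set r *: t ^+ n | r in Rg (alpha * gamma ^- n)%g])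
    (ore_component alpha).
Proof.
apply: direct_sum_intro => [n||n|P closedP monP|S F monF sumF n nS].
- apply: zmod_closed_in; first by exists 0; [exact: closed0|rewrite scale0r].
  move=> _ _ [x Rx <-] [y Ry <-]; exists (x - y); first exact: closedB.
  by rewrite scalerBl.
- exact: ore_component_closed.
- by move=> _ [r Rr <-]; exact: ore_component_monomial.
- by apply: ore_component_ind => // n r Rr; apply: (monP n); exists r.
have coefF m : m != n -> (psi (F m))`_n = 0.
  case: (monF m) => r _ <-; rewrite psi_monomial coefZ coefXn eq_sym.
  by move=> /negbTE->; rewrite mulr0.
have : (psi (\sum_(m <- S) F m))`_n = 0 by rewrite sumF raddf0 coef0.
rewrite raddf_sum coef_sum (bigD1_seq n) ?fset_uniq //= [X in _ + X]big1 //.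
rewrite addr0; case: (monF n) => r _ <-.
by rewrite psi_monomial coefZ coefXn eqxx mulr1 => ->; rewrite scale0r.
Qed.

(** A graded extension contains [t^n] in degree [gamma^n] (for [n = 0] because
    [1] has neutral degree in [R]), hence contains every [ore_component];
    both families being direct sum decompositions of [A], they are equal. *)
Lemma graded_extension_eq (Ag : G -> set A) :
  is_graded_extension Rg t gamma Ag -> Ag = ore_component.
Proof.
move=> [gradA RA At]; have [dsA mulA] := gradA.
symmetry; apply: (direct_sum_eq ore_component_direct_sum dsA) => alpha.
have At_n n : Ag (gamma ^+ n)%g (t ^+ n).
  elim: n => [|n IH]; last by rewrite exprS expgS; exact: mulA.
  by rewrite expr0 expg0; exact: grading_one.
apply: ore_component_ind => [|n r Rr]; first exact: dsA.1.
rewrite -mulr_algl -[alpha](mulgVK (gamma ^+ n)%g).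
by apply: mulA => //; apply: RA; exists r.
Qed.

(** * Compatibility *)

Section Commutation.
Variables (sigma : {rmorphism R -> R}) (delta : {additive R -> R}).
Hypothesis t_comm : forall r : R, t * r%:A = sigma r *: t + (delta r)%:A.

(** Both conditions are read off the coefficients of
    [t r = sigma(r) t + delta(r)], which has degree [gamma * tau]. *)
Lemma graded_extension_compatible (Ag : G -> set A) :
  is_graded_extension Rg t gamma Ag -> is_compatible Rg sigma delta gamma.
Proof.
move=> extA; have eqA := graded_extension_eq extA.
case: extA => -[_ mulA] RA At tau.
have coef_comm r n : Rg tau r ->
    Rg (gamma * tau * gamma ^- n)%g ((sigma r *: 'X + (delta r)%:P)`_n).
  move=> Rr; have : Ag (gamma * tau)%g (t * r%:A).
    by apply: mulA => //; apply: RA; exists r.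
  rewrite t_comm eqA => /(_ n).
  rewrite raddfD -(expr1 t) -(expr0 t) !psi_monomial expr0.
  by rewrite alg_polyC.
split=> _ [r Rr <-].
  have := coef_comm r 1%N Rr.
  by rewrite coefD coefZ coefX coefC mulr1 addr0 expg1.
have := coef_comm r 0%N Rr.
by rewrite coefD coefZ coefX coefC mulr0 add0r expg0 invg1 mulg1.
Qed.

(** The degree rule for [a * b] is additive in each factor, so it suffices to
    treat [a = r t^n].  Left multiplication by [t] shifts degrees by [gamma] on
    monomials, by compatibility; the general case follows by iterating it and
    multiplying by [r]. *)
Lemma compatible_graded_extension :
  is_compatible Rg sigma delta gamma ->
  is_graded_extension Rg t gamma ore_component.
Proof.
move=> compat.
have t_mon r n : t * (r *: t ^+ n) = sigma r *: t ^+ n.+1 + delta r *: t ^+ n.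
  by rewrite -mulr_algl mulrA t_comm mulrDl mulr_algl -scalerAl -exprS.
have preimage_closed (b : A) beta :
    zmod_closed [in [set a | ore_component beta (b * a)]].
  apply: zmod_closed_in => [|x y /= Bx By].
    by rewrite /= mulr0; exact: (closed0 (ore_component_closed _)).
  by rewrite mulrBr; exact: (closedB (ore_component_closed _)).
have t_shift tau b :
    ore_component tau b -> ore_component (gamma * tau)%g (t * b).
  move: b; apply: (ore_component_ind (preimage_closed t _)) => n r Rr /=.
  rewrite t_mon; apply: (closedD (ore_component_closed _)).
    apply: ore_component_monomial; rewrite expgS invgM !mulgA -(mulgA gamma).
    by apply: (compat _).1; exists r.
  apply: ore_component_monomial; rewrite -mulgA.
  by apply: (compat _).2; exists r.
have tn_shift n tau b :
    ore_component tau b -> ore_component (gamma ^+ n * tau)%g (t ^+ n * b).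
  move=> Bb; elim: n => [|n IH]; first by rewrite expg0 mul1g mul1r.
  by rewrite exprS expgS -mulrA -mulgA; exact: t_shift.
have r_shift rho tau r b : Rg rho r -> ore_component tau b ->
    ore_component (rho * tau)%g (r *: b).
  move=> Rr Bb; rewrite -mulr_algl.
  move: b Bb; apply: (ore_component_ind (preimage_closed _ _)) => n s Rs /=.
  rewrite mulr_algl scalerA; apply: ore_component_monomial; rewrite -mulgA.
  exact: gradR.2.
split; first split.
- exact: ore_component_direct_sum.
- move=> rho tau a b Ba Bb; move: a Ba.
  apply: ore_component_ind => [|n r Rr].
    apply: zmod_closed_in => [|x y /= Bx By].
      by rewrite /= mul0r; exact: (closed0 (ore_component_closed _)).
    by rewrite mulrBl; exact: (closedB (ore_component_closed _)).
  rewrite /= -scalerAl -[rho](mulgVK (gamma ^+ n)%g) -mulgA.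
  by apply: r_shift => //; exact: tn_shift.
- move=> tau _ [r Rr <-]; rewrite -(expr0 t); apply: ore_component_monomial.
  by rewrite expg0 invg1 mulg1.
rewrite -[t]scale1r -[t in _ *: t]expr1; apply: ore_component_monomial.
by rewrite expg1 mulgV; exact: grading_one.
Qed.

End Commutation.
End OreGrading.

Theorem theorem1 (G : groupType) (R : nzRingType) (Rg : G -> set R)
    (hRg : is_grading Rg)
    (sigma : {rmorphism R -> R}) (delta : {additive R -> R})
    (hdelta : is_skew_derivation sigma delta)
    (A : lalgType R) (t : A) (hA : is_ore_extension sigma delta t)
    (gamma : G) :
  [/\ (exists Ag : G -> set A, is_graded_extension Rg t gamma Ag) <->
        is_compatible Rg sigma delta gamma,
      forall Ag Ag' : G -> set A,
        is_graded_extension Rg t gamma Ag ->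
        is_graded_extension Rg t gamma Ag' -> Ag = Ag'
    & forall Ag : G -> set A,
        is_graded_extension Rg t gamma Ag ->
        forall alpha : G,
          is_direct_sum
            (fun n : nat => [set r *: t ^+ n | r in Rg (alpha * gamma ^- n)%g])
            (Ag alpha)].
Proof.
have [psi [psiK psi_monomial]] := ore_coefficients hA.
have t_comm := hA.2.
have Ag_eq := graded_extension_eq hRg psiK psi_monomial.
split=> [|Ag Ag' /Ag_eq-> /Ag_eq-> //|Ag /Ag_eq-> alpha].
  split=> [[Ag]|compat].
    exact: (graded_extension_compatible hRg psiK psi_monomial t_comm).
  exists (ore_component Rg gamma psi).
  exact: compatible_graded_extension t_comm compat.
exact: ore_component_monomials.
Qed.
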